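(* For every input multiset $D$ of item sizes and every integer $k\geq 1$, $FFk(D_k) \leq \left(1.5+\frac{1}{5k}\right) \cdot OPT(D_k) + 3\cdot k$.
   Context: In the $k$-times bin-packing problem ($k$BP), the input is a multiset $D$ of $n$ positive item sizes, a bin capacity $S>0$, and an integer $k\geq 1$; the goal is to pack the items into the fewest bins so that the sum of item sizes in each bin is at most $S$, each item appears in exactly $k$ different bins, and no bin contains two copies of the same item. $D_k := DD\ldots D$ denotes the sequence consisting of $k$ consecutive copies of $D$ (first all items of instance 1, then all items of instance 2, etc.), and $OPT(D_k)$ is the optimal number of bins for the $k$BP instance. The algorithm $FFk$ (the $k$-times version of First-Fit) processes the items of $D_k$ in this order; each item is placed into the lowest-indexed currently open bin that (a) has enough remaining capacity for it and (b) does not already contain a copy of the same item; if no such bin exists, a new bin is opened for it. $FFk(D_k)$ denotes the number of bins used by $FFk$. *)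

(* Defs.v *)
From HB Require Import structures.
From mathcomp Require Import all_boot all_order all_algebra.
Set Implicit Arguments. Unset Strict Implicit. Unset Printing Implicit Defensive.
Import Order.TTheory GRing.Theory Num.Theory.
Local Open Scope ring_scope.

Section KBP.
Variable R : realFieldType.

(* Items are identified by their index j < size D; the size of item j is D`_j.
   A bin is represented by the sequence of (indices of) items it contains. *)

Definition load (D : seq R) (b : seq nat) : R := \sum_(j <- b) D`_j.

Definition fits (D : seq R) (S : R) (i : nat) (b : seq nat) : bool :=
  (load D b + D`_i <= S) && (i \notin b).

Fixpoint ff_insert (D : seq R) (S : R) (i : nat) (bins : seq (seq nat))
  : seq (seq nat) :=
  match bins with
  | [::] => [:: [:: i]]
  | b :: bs => if fits D S i b then (i :: b) :: bs else b :: ff_insert D S i bs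
  end.

Definition Dk_order (D : seq R) (k : nat) : seq nat :=
  flatten (nseq k (iota 0 (size D))).

Definition FFk_bins (D : seq R) (S : R) (k : nat) : seq (seq nat) :=
  foldl (fun bins i => ff_insert D S i bins) [::] (Dk_order D k).

Definition FFk (D : seq R) (S : R) (k : nat) : nat := size (FFk_bins D S k).

(* A feasible kBP packing with m bins: each bin is a set of items (so no bin
   contains two copies of the same item), each bin has total size <= S, and
   each item lies in exactly k bins. *)
Definition feasible_kpacking (D : seq R) (S : R) (k : nat) (m : nat)
  (P : m.-tuple {set 'I_(size D)}) : bool :=
  [forall b : 'I_m, \sum_(j in tnth P b) D`_j <= S] &&
  [forall j : 'I_(size D), count (fun B : {set 'I_(size D)} => j \in B) P == k].

(* OPT(D_k): the least number of bins of a feasible kBP packing.  When all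
   items have size <= S, a feasible packing with (size D * k) bins exists
   (every copy alone in its bin), so the minimum is over m <= size D * k;
   the default value is never used in that case. *)
Definition OPT (D : seq R) (S : R) (k : nat) : nat :=
  \big[minn/(size D * k)%N]_(m < (size D * k).+1
     | [exists P : m.-tuple {set 'I_(size D)}, feasible_kpacking S k P]) m.

End KBP.

(* Main.v *)
(* Scale the capacity to 1. Give an item of size a the weight 6/5 a + bonus a of the
   classical First-Fit analysis, but with bonus 1/5 instead of 2/5 for items larger
   than 1/2, so that a feasible bin weighs at most 3/2 (instead of 17/10). Every bin
   opened in a round weighs 1 on average at the end of it, up to a loss of 3 bins
   per round, except the bins holding one item a in (1/2, 2/3), which lack
   deficit a <= 1/5. These deficits are paid by the next round, or else that round
   opens only bins with items larger than 1/3, which are counted directly by giving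
   weight 1 to items above 1/2 and weight 1/2 to those in (1/3, 1/2]. The deficits
   thus telescope over the rounds; only those of the last round remain, and they
   amount to at most OPT/(5k). *)
Require Import Defs.
From HB Require Import structures.
From mathcomp Require Import all_boot all_order all_algebra.
From mathcomp Require Import ring lra.
Import Order.TTheory GRing.Theory Num.Theory.
Local Open Scope ring_scope.

Ltac split_cases :=
  repeat match goal with
  | |- context [if ?x <= ?y then _ else _] => case: (lerP x y) => ?
  end.

(** * Weight functions and their sums over a unit bin *)

Section Weights.
Context {R : realFieldType}.
Implicit Types (x y a c : R) (s : seq R) (f : R -> R).

Definition bonus x : R :=
  if x <= 1/6 then 0 else if x <= 1/3 then 3/5 * (x - 1/6)
  else if x <= 1/2 then 1/10 else 1/5.

Definition weight x : R := 6/5 * x + bonus x.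

(** On (1/2, 2/3] this equals both 1 - [weight x] and 6/5 (2/3 - x), so filling the bin of a lone
    item [x] up to 2/3 pays for it. *)
Definition deficit x : R :=
  if x <= 1/2 then 0 else if x <= 2/3 then 4/5 - 6/5 * x else 0.

Definition count_weight x : R :=
  if x <= 1/3 then 0 else if x <= 1/2 then 1/2 else 1.

Lemma bonus_ge0 x : 0 <= bonus x.
Proof. rewrite /bonus; split_cases; lra. Qed.

(** If a bin leaves the gap [y], two items larger than [y] have total bonus at least 6/5 y - 1/5,
    which is what 6/5 (1 - y) lacks to 1. *)
Lemma bonus_gt_gap x y : y < x -> y <= 1/3 -> 3/5 * (y - 1/6) <= bonus x.
Proof. rewrite /bonus; split_cases; lra. Qed.

Lemma weight_ge x : 6/5 * x <= weight x.
Proof. by rewrite /weight lerDl bonus_ge0. Qed.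

Lemma deficit_ge0 x : 0 <= deficit x.
Proof. rewrite /deficit; split_cases; lra. Qed.

Lemma deficit_le_count x : deficit x <= count_weight x.
Proof. rewrite /deficit /count_weight; split_cases; lra. Qed.

Lemma count_deficit_ge x : 1/3 < x -> 1/2 <= count_weight x - deficit x.
Proof. rewrite /deficit /count_weight; split_cases; lra. Qed.

Lemma weight_deficit_ge x : 1/2 < x -> 1 <= weight x + deficit x.
Proof. rewrite /weight /bonus /deficit; split_cases; lra. Qed.

Lemma sum_superadditive f s :
  (forall x y, 0 <= x -> 0 <= y -> x + y <= 1/2 -> f x + f y <= f (x + y)) ->
  f 0 = 0 -> {in s, forall x, 0 <= x} -> \sum_(x <- s) x <= 1/2 ->
  \sum_(x <- s) f x <= f (\sum_(x <- s) x).
Proof.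
move=> fD f0; elim: s => [|x s IHs] s_ge0; first by rewrite !big_nil f0.
have x_ge0 : 0 <= x by rewrite s_ge0 ?mem_head.
have {}s_ge0 : {in s, forall y, 0 <= y}.
  by move=> y ys; rewrite s_ge0 // inE ys orbT.
have sum_ge0 : 0 <= \sum_(y <- s) y by rewrite big_seq sumr_ge0.
rewrite !big_cons => le_half.
apply: le_trans (fD _ _ x_ge0 sum_ge0 le_half).
by rewrite lerD2l IHs //; lra.
Qed.

(* A unit bin contains at most one item larger than 1/2; without such an item
   the linear bound applies, with it the other items fit in 1/2 and can be merged. *)
Lemma sum_bin_le f c s : 0 <= c ->
  (forall x, 0 <= x -> x <= 1/2 -> f x <= c * x) ->
  (forall x y, 0 <= x -> 0 <= y -> x + y <= 1/2 -> f x + f y <= f (x + y)) ->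
  (forall x y, 1/2 < x -> 0 <= y -> x + y <= 1 -> f x + f y <= c) ->
  f 0 = 0 -> {in s, forall x, 0 <= x} -> \sum_(x <- s) x <= 1 ->
  \sum_(x <- s) f x <= c.
Proof.
move=> c0 flin fD fbig f0 s_ge0 le1.
have [/hasP[x xs /= x_big]|/hasPn no_big] := boolP (has (fun x => 1/2 < x) s).
  have perm_s := perm_to_rem xs.
  move: le1; rewrite !(perm_big _ perm_s) /= !big_cons => le1.
  have rem_ge0 : {in rem x s, forall y, 0 <= y}.
    by move=> y /mem_rem; apply: s_ge0.
  have sum_ge0 : 0 <= \sum_(y <- rem x s) y by rewrite big_seq sumr_ge0.
  apply: le_trans (fbig _ _ x_big sum_ge0 le1).
  by rewrite lerD2l sum_superadditive //; lra.
apply: (@le_trans _ _ (\sum_(x <- s) c * x)).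
  rewrite big_seq [leRHS]big_seq; apply: ler_sum => x xs.
  by rewrite flin ?s_ge0 // leNgt no_big.
by rewrite -mulr_sumr ler_piMr.
Qed.

(** Up to 1/2 the ratio of weight to size is at most 3/2, attained at 1/3. Next to an item above 1/2
    the rest merges into a bonus of at most 1/10, and 6/5 + 1/5 + 1/10 = 3/2. *)
Lemma sum_weight_bin s : {in s, forall x, 0 <= x} -> \sum_(x <- s) x <= 1 ->
  \sum_(x <- s) weight x <= 3/2.
Proof.
by apply: sum_bin_le; rewrite /weight /bonus; first lra;
  move=> *; split_cases; lra.
Qed.

Lemma sum_count_weight_bin s : {in s, forall x, 0 <= x} ->
  \sum_(x <- s) x <= 1 -> \sum_(x <- s) count_weight x <= 3/2.
Proof.
by apply: sum_bin_le; rewrite /count_weight; first lra;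
  move=> *; split_cases; lra.
Qed.

Lemma sum_deficit_bin s : {in s, forall x, 0 <= x} ->
  \sum_(x <- s) x <= 1 -> \sum_(x <- s) deficit x <= 1/5.
Proof.
have deficit0 x : x <= 1/2 -> deficit x = 0.
  by rewrite /deficit => ->.
apply: sum_bin_le; first lra.
- by move=> x ? ?; rewrite deficit0 //; lra.
- by move=> x y ? ? ?; rewrite !deficit0 //; lra.
- move=> x y ? ? ?; rewrite (deficit0 y); last lra.
  by rewrite /deficit; split_cases; lra.
- by rewrite deficit0 //; lra.
Qed.

End Weights.

(** Applied to kinds of bins whose members cannot block each other: a round opens at most one of
    each. *)
Lemma count_pairwise_le1 (T : Type) (P : pred T) (r : rel T) (s : seq T) :
  (forall x y, P x -> P y -> ~~ r x y) -> pairwise r s -> (count P s <= 1)%N.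
Proof.
move=> nr /(pairwise_filter P).
rewrite -size_filter; have := filter_all P s.
case: (filter P s) => [|x [|y s']] //= /and3P[Px Py _] /andP[/andP[rxy _] _].
by have := nr x y Px Py; rewrite rxy.
Qed.

(** * First-Fit on a sequence of distinct items *)

Section FirstFit.
Context {R : realFieldType} (D : seq R) (S : R).
Hypotheses (S_gt0 : 0 < S) (D_ge0 : forall j, 0 <= D`_j).
Implicit Types (b p q : seq nat) (bins : seq (seq nat)) (x y : nat).

Let d x : R := D`_x / S.
Let vol b : R := \sum_(x <- b) d x.
Let wt b : R := \sum_(x <- b) weight (d x).
Let insert bins x := ff_insert D S x bins.

Let d_ge0 x : 0 <= d x.
Proof. by rewrite divr_ge0 // ltW. Qed.

Let vol_ge0 b : 0 <= vol b.
Proof. exact: sumr_ge0. Qed.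

Lemma fitsE x b : fits D S x b = (vol b + d x <= 1) && (x \notin b).
Proof.
rewrite /fits /vol /load /d -mulr_suml -mulrDl.
by rewrite ler_pdivrMr // mul1r.
Qed.

(** The first bin keeps [p]; what it rejects runs through the other bins alone. A rejection for lack
    of room stays valid because the bin only grows. *)
Lemma ff_bin s b bins : uniq s -> exists p q,
  [/\ foldl insert (b :: bins) s = (p ++ b) :: foldl insert bins q,
      perm_eq s (p ++ q) &
      {in q, forall x, x \in b \/ 1 < vol (p ++ b) + d x}].
Proof.
elim: s b bins => [|x s IHs] b bins /=.
  by move=> _; exists [::], [::].
case/andP=> xNs s_uniq; rewrite {2}/insert /=; case: ifPn => [_|].
  have [p [q [-> perm_s rej]]] := IHs (x :: b) bins s_uniq.
  exists (rcons p x), q; split; first by rewrite cat_rcons.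
    by rewrite cat_rcons perm_sym (perm_catCA p [:: x]) /= perm_cons perm_sym.
  move=> y yq; rewrite cat_rcons.
  have ys : y \in s by rewrite (perm_mem perm_s) mem_cat yq orbT.
  (* Items of [s] are distinct, so [y] can only repeat an item of the old content [b]. *)
  have yx : y != x by apply: contraNneq xNs => <-.
  by have [|] := rej y yq; [rewrite inE (negPf yx); left | right].
rewrite fitsE negb_and -ltNge negbK => xrej.
have [p [q [foldlE perm_s rej]]] := IHs b (ff_insert D S x bins) s_uniq.
exists p, (x :: q); split; first by rewrite /= -foldlE.
  by rewrite perm_sym (perm_catCA p [:: x]) /= perm_cons perm_sym.
move=> y; rewrite inE => /predU1P[->|]; last exact: rej.
case/orP: xrej => [lt1|]; [right | by left].
apply: lt_le_trans lt1 _; rewrite lerD2r /vol big_cat /= lerDr.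
exact: vol_ge0.
Qed.

(* [pb] lists, for each bin already open, what [s] adds to it and what it contained. *)
Lemma ff_bins s bins : uniq s -> exists (pb : seq (seq nat * seq nat)) q,
  [/\ [seq t.2 | t <- pb] = bins,
      foldl insert bins s
        = [seq t.1 ++ t.2 | t <- pb] ++ foldl insert [::] q,
      perm_eq s (flatten [seq t.1 | t <- pb] ++ q) &
      {in pb & q, forall t x, x \in t.2 \/ 1 < vol (t.1 ++ t.2) + d x}].
Proof.
elim: bins s => [|b bins IHb] s s_uniq.
  by exists [::], s; split.
have [p [q [-> perm_s rej]]] := ff_bin s b bins s_uniq.
have q_uniq : uniq q.
  by move: s_uniq; rewrite (perm_uniq perm_s) cat_uniq => /and3P[].
have [pb [q' [<- -> perm_q rej']]] := IHb q q_uniq.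
exists ((p, b) :: pb), q'; split=> //=.
  by rewrite (perm_trans perm_s) // -catA perm_cat2l.
move=> t x; rewrite inE => /predU1P[->|] xq; last exact: rej'.
by apply: rej; rewrite (perm_mem perm_q) mem_cat xq orbT.
Qed.

(** Only volume is compared: between bins opened in the same round, no item can be rejected as a
    second copy. *)
Definition blocks b b' := all (fun x => 1 < vol b + d x) b'.

Lemma ff_new_bins q : uniq q ->
  let bins := foldl insert [::] q in
  [/\ perm_eq q (flatten bins), [::] \notin bins & pairwise blocks bins].
Proof.
(* The recursion is on what the first new bin rejects, not on the tail of [q]. *)
have [n] := ubnP (size q); elim: n q => // n IHn [|x q] //=.
rewrite ltnS => size_q /andP[xNq q_uniq].
rewrite {1 2 3}/insert /=.
have [p [q' [-> perm_q rej]]] := ff_bin q [:: x] [::] q_uniq.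
have q'_uniq : uniq q'.
  by move: q_uniq; rewrite (perm_uniq perm_q) cat_uniq => /and3P[].
have size_q' : (size q' < n)%N.
  by rewrite (leq_ltn_trans _ size_q) // (perm_size perm_q) size_cat leq_addl.
have [perm_q' nonempty pair_q'] := IHn q' size_q' q'_uniq.
split.
- rewrite /= -catA perm_sym (perm_catCA p [:: x]) /= perm_cons perm_sym.
  by rewrite (perm_trans perm_q) // perm_cat2l.
- by rewrite inE negb_or nonempty andbT; case: (p).
rewrite /= pair_q' andbT; apply/allP=> b b_bin; apply/allP=> y yb.
have yq' : y \in q' by rewrite (perm_mem perm_q'); apply/flattenP; exists b.
have [|//] := rej y yq'; rewrite inE => /eqP eq_yx.
by rewrite -eq_yx (perm_mem perm_q) mem_cat yq' orbT in xNq.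
Qed.

(** * Weight of the bins opened in one round *)

Let lone_deficit b : R := if b is [:: x] then deficit (d x) else 0.
Let gain x : R := count_weight (d x) - deficit (d x).

(** Any other nonempty bin holds one item, either above 1/2 or [small_lone]. The loss of 3 per round
    is 1 for the chain of full bins and 1 each for a thin and a small lone bin. *)
Let full b := (1 < size b)%N && (2/3 <= vol b).
Let thin b := (1 < size b)%N && (vol b < 2/3).
Let small_lone b := if b is [:: x] then d x <= 1/2 else false.

Lemma small_lone_le1 bins :
  pairwise blocks bins -> (count small_lone bins)%:R <= 1 :> R.
Proof.
move=> pair_bins.
rewrite lern1; apply: count_pairwise_le1 pair_bins => -[|x []] // [|y []] //=.
rewrite /blocks /= andbT /vol big_seq1 -leNgt; lra.
Qed.

Lemma lone_deficit_sum_le s e bins : perm_eq s (e ++ flatten bins) ->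
  \sum_(b <- bins) lone_deficit b <= \sum_(x <- s) deficit (d x).
Proof.
move=> perm_s; rewrite (perm_big _ perm_s) big_cat /= big_flatten /=.
apply: ler_wpDl; first by apply: sumr_ge0 => x _; apply: deficit_ge0.
apply: ler_sum => -[|x [|y b]] _ /=; rewrite ?big_nil ?big_seq1 //.
by apply: sumr_ge0 => z _; apply: deficit_ge0.
Qed.

(* The items of a full bin exceed the gap left by the previous full bin, so their
   bonuses make up for that gap. *)
Lemma full_bins_le bins : all full bins -> pairwise blocks bins ->
  (size bins)%:R <= \sum_(b <- bins) wt b + 1.
Proof.
case: bins => [|b bins]; first by rewrite big_nil add0r.
(* Each bin borrows from the bonuses of the next one; the last bin has no successor, hence the
   [+ 1]. *)
suff chain : all full (b :: bins) -> pairwise blocks (b :: bins) ->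
    (size bins)%:R <= 6/5 * vol b + \sum_(c <- bins) wt c.
  move=> fb pb; have := chain fb pb; rewrite /= big_cons -natr1.
  have : 6/5 * vol b <= wt b.
    by rewrite /vol mulr_sumr; apply: ler_sum => x _; apply: weight_ge.
  by lra.
elim: bins b => [|c bins IHb] b.
  by move=> _ _; rewrite big_nil addr0 mulr_ge0 ?vol_ge0 //; lra.
move=> /andP[/andP[_ volb] fc] /= /andP[/andP[bc _] pc].
have := IHb c fc pc; rewrite big_cons /= -natr1.
have -> : wt c = 6/5 * vol c + \sum_(x <- c) bonus (d x).
  by rewrite /wt big_split /= -mulr_sumr.
have bonus_sum_ge0 (e : seq nat) : 0 <= \sum_(x <- e) bonus (d x).
  by apply: sumr_ge0 => x _; apply: bonus_ge0.
suff : 1 <= 6/5 * vol b + \sum_(x <- c) bonus (d x) by lra.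
have [vol_ge|vol_lt] := lerP (5/6) (vol b).
  by have := bonus_sum_ge0 c; lra.
case/andP: fc => /andP[+ _] _; move: bc; rewrite /blocks.
case: c {pc IHb} => [|x [|y c]] //= /and3P[ltx lty _] _.
rewrite !big_cons; have := bonus_sum_ge0 c.
have gap_le : 1 - vol b <= 1/3 by lra.
have := bonus_gt_gap (d x) (1 - vol b); have := bonus_gt_gap (d y) (1 - vol b).
move=> /(_ _ gap_le) Hy /(_ _ gap_le) Hx.
have {}Hx := Hx ltac:(lra); have {}Hy := Hy ltac:(lra).
lra.
Qed.

Lemma ff_weight_le bins : [::] \notin bins -> pairwise blocks bins ->
  (size bins)%:R <=
    \sum_(b <- bins) wt b + \sum_(b <- bins) lone_deficit b + 3.
Proof.
move=> nonempty pair_bins.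
have wt_ge b : 6/5 * vol b <= wt b.
  by rewrite /vol mulr_sumr; apply: ler_sum => x _; apply: weight_ge.
have wt_ge0 b : 0 <= wt b.
  by apply: le_trans (wt_ge b); rewrite mulr_ge0 ?vol_ge0 //; lra.
have lone_ge0 b : 0 <= lone_deficit b.
  by case: b => [|x []] //=; apply: deficit_ge0.
(* Two items rejected by a bin filled below 2/3 exceed 1/3 each, so together they exceed 2/3. *)
have thin_le1 : ((count thin bins)%:R <= 1 :> R).
  rewrite lern1; apply: count_pairwise_le1 pair_bins => b c.
  case/andP=> _ vb /andP[sc vc]; apply/negP; rewrite /blocks.
  case: c sc vc => [|x [|y c]] //= _; rewrite /vol !big_cons => vc.
  case/and3P=> ltx lty _; have := vol_ge0 c; move: vb ltx lty vc.
  rewrite /vol /d; lra.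
have lone_le1 := small_lone_le1 bins pair_bins.
have full_le := full_bins_le (filter full bins) (filter_all _ _)
                  (pairwise_filter full pair_bins).
rewrite size_filter big_filter in full_le.
suff : (size bins)%:R <= (count full bins)%:R + (count thin bins)%:R
    + (count small_lone bins)%:R
    + \sum_(b <- bins | ~~ full b) wt b + \sum_(b <- bins) lone_deficit b.
  by rewrite [\sum_(b <- bins) wt b](bigID full) /=; lra.
elim: bins nonempty {pair_bins thin_le1 lone_le1 full_le}
    => [|b bins IHb]; first by rewrite !big_nil /= !addr0.
rewrite inE negb_or => /andP[b0 /IHb{IHb}] IH.
rewrite /= !big_cons -natr1 !natrD; move: IH.
set X := \sum_(_ <- _ | _) _; set Y := \sum_(_ <- _) _ => IH.
suff : 1 <= (full b)%:R + (thin b)%:R + (small_lone b)%:R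
    + (if ~~ full b then wt b else 0) + lone_deficit b :> R.
  by case: (full b) => /=; lra.
have := lone_ge0 b; have := wt_ge0 b; rewrite /full /thin /small_lone.
case: b b0 => [|x [|y b]] //= _.
  rewrite /wt /vol !big_seq1 => _ _; have := weight_deficit_ge (d x).
  by case: (lerP (d x) (1/2)) => /= [_ _|_ /(_ isT)];
     have := weight_ge (d x); have := d_ge0 x; have := deficit_ge0 (d x); lra.
by case: ltrP => /=; lra.
Qed.

(** Two items above 1/3 gain at least 1/2 each; a lone item above 1/2 has gain plus deficit 1; at
    most one lone item is smaller. *)
Lemma ff_large_items_le bins : [::] \notin bins ->
  pairwise blocks bins ->
  {in flatten bins, forall x, 1/3 < d x} ->
  (size bins)%:R <= \sum_(b <- bins) \sum_(x <- b) gain x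
    + \sum_(b <- bins) lone_deficit b + 1.
Proof.
move=> nonempty pair_bins large.
have gain_ge0 x : 0 <= gain x by rewrite subr_ge0 deficit_le_count.
have lone_le1 := small_lone_le1 bins pair_bins.
suff : (size bins)%:R <= \sum_(b <- bins) \sum_(x <- b) gain x
    + \sum_(b <- bins) lone_deficit b + (count small_lone bins)%:R by lra.
elim: bins nonempty large {pair_bins lone_le1}
    => [|b bins IHb]; first by rewrite !big_nil /= !addr0.
rewrite inE negb_or => /andP[b0 /IHb{IHb}] IH large.
have {}IH := IH (fun x xb => large x ltac:(by rewrite /= mem_cat xb orbT)).
have {}large : {in b, forall x, 1/3 < d x}.
  by move=> x xb; apply: large; rewrite /= mem_cat xb.
rewrite /= !big_cons -natr1 !natrD.
suff : 1 <= \sum_(x <- b) gain x + lone_deficit b + (small_lone b)%:R by lra.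
case: b b0 large => [|x [|y b]] //= _ large.
  rewrite big_seq1 /gain /count_weight /deficit.
  have := large x (mem_head _ _).
  by split_cases; rewrite /=; lra.
have := count_deficit_ge _ (large x (mem_head _ _)).
have := count_deficit_ge (d y) ltac:(by apply: large; rewrite !inE eqxx orbT).
have : 0 <= \sum_(z <- b) gain z by apply: sumr_ge0.
rewrite !big_cons /gain; lra.
Qed.

(** * Accounting over successive rounds *)

Let items := iota 0 (size D).
Let rounds r := foldl insert [::] (flatten (nseq r items)).

(* [bins] are the bins opened in the previous round, [bins'] those opened in this
   one. If some item of size at most 1/3 enters [bins'], then it was rejected by
   every lone large item of [bins], so this round filled those bins up to 2/3 and
   thereby paid their deficits. Otherwise [bins'] holds only items above 1/3, and
   counting them suffices. *)
Lemma round_step beta old bins e :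
  \sum_(x <- items) weight (d x) <= beta ->
  \sum_(x <- items) count_weight (d x) <= beta ->
  perm_eq items (e ++ flatten bins) ->
  exists old' bins' e', [/\ foldl insert (old ++ bins) items = old' ++ bins',
    size old' = size (old ++ bins), perm_eq items (e' ++ flatten bins') &
    (size bins')%:R <= beta + \sum_(b <- bins') lone_deficit b
                       - \sum_(b <- bins) lone_deficit b + 3].
Proof.
move=> le_wt le_count perm_bins.
have items_uniq : uniq items by apply: iota_uniq.
have [pb [q [eq_old -> perm_items rej]]] :=
  ff_bins items (old ++ bins) items_uniq.
have q_uniq : uniq q.
  by move: items_uniq; rewrite (perm_uniq perm_items) cat_uniq => /and3P[].
have [perm_q nonempty pair_q] := ff_new_bins q q_uniq.
exists [seq t.1 ++ t.2 | t <- pb], (foldl insert [::] q),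
  (flatten [seq t.1 | t <- pb]).
split=> //; first by rewrite -eq_old !size_map.
  by rewrite (perm_trans perm_items) // perm_cat2l.
set N := foldl _ _ _ in perm_q nonempty pair_q *.
have sumN f : \sum_(b <- N) \sum_(x <- b) f x = \sum_(x <- q) f x :> R.
  by rewrite (perm_big _ perm_q) /= big_flatten.
have [/hasP[x xq /= small_x]|/hasPn no_small] :=
    boolP (has (fun x => d x <= 1/3) q); last first.
  have /(ff_large_items_le _ nonempty pair_q) :
      {in flatten N, forall x, 1/3 < d x}.
    by move=> x; rewrite -(perm_mem perm_q) => /no_small; rewrite -ltNge.
  rewrite sumN => le_N.
  (* Total gain is total count weight minus all deficits, and these cover the lone deficits of
     [bins]. *)
  have gain_le : \sum_(x <- q) gain x <= \sum_(x <- items) gain x.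
    rewrite (perm_big _ perm_items) big_cat /= lerDr.
    by apply: sumr_ge0 => x _; rewrite subr_ge0 deficit_le_count.
  have lone_le := lone_deficit_sum_le _ _ _ perm_bins.
  move: gain_le; rewrite [leRHS]big_split /= sumrN; lra.
have := ff_weight_le N nonempty pair_q; rewrite sumN => le_N.
suff : \sum_(b <- bins) lone_deficit b
    <= \sum_(x <- flatten [seq t.1 | t <- pb]) weight (d x).
  by move: le_wt; rewrite (perm_big _ perm_items) big_cat /=; lra.
have weight_ge0 y : 0 <= weight (d y).
  by apply: le_trans (weight_ge _); rewrite mulr_ge0 // ; lra.
have lone_ge0 b : 0 <= lone_deficit b.
  by case: b => [|z []] //=; apply: deficit_ge0.
apply: (@le_trans _ _ (\sum_(b <- old ++ bins) lone_deficit b)).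
  by rewrite big_cat /= lerDr sumr_ge0.
rewrite -eq_old big_map big_flatten /= big_map.
rewrite big_seq [leRHS]big_seq; apply: ler_sum => -[p b] pb_in /=.
case: b pb_in => [|y [|z b]] pb_in /=; [exact: sumr_ge0| |exact: sumr_ge0].
rewrite /deficit; split_cases; try exact: sumr_ge0.
have [|] := rej _ _ pb_in xq; rewrite /=.
  by rewrite inE => /eqP xy; move: small_x; rewrite xy; lra.
rewrite /vol big_cat /= big_seq1 => lt1.
(* Since [x] has size at most 1/3 and did not fit, [p] has volume above 2/3 minus the size of
   [y]. *)
apply: (@le_trans _ _ (6/5 * vol p)); first by move: lt1 small_x; rewrite /vol /d; lra.
by rewrite /vol mulr_sumr; apply: ler_sum => u _; apply: weight_ge.
Qed.

Lemma rounds_le beta r :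
  \sum_(x <- items) weight (d x) <= beta ->
  \sum_(x <- items) count_weight (d x) <= beta ->
  (size (rounds r))%:R
    <= r%:R * beta + \sum_(x <- items) deficit (d x) + 3 * r%:R.
Proof.
move=> le_wt le_count.
(* The invariant singles out the bins of the last round, the only ones with unpaid deficits. *)
suff [old [bins [e [-> perm_bins le_size]]]] : exists old bins e,
    [/\ rounds r = old ++ bins, perm_eq items (e ++ flatten bins) &
      (size (old ++ bins))%:R
        <= r%:R * beta + \sum_(b <- bins) lone_deficit b + 3 * r%:R].
  apply: le_trans le_size _; rewrite lerD2r lerD2l.
  exact: lone_deficit_sum_le perm_bins.
elim: r => [|r [old [bins [e [eq_r perm_bins le_size]]]]].
  by exists [::], [::], items; split; rewrite ?cats0 // big_nil mul0r mulr0 !addr0.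
have [old' [bins' [e' [eq_bins size_old' perm_bins' le_bins']]]] :=
  round_step beta old bins e le_wt le_count perm_bins.
exists old', bins', e'; split=> //.
  rewrite -eq_bins -eq_r /rounds -foldl_cat; congr foldl.
  by rewrite -addn1 nseqD flatten_cat /= cats0.
rewrite size_cat natrD size_old' -natr1; lra.
Qed.

End FirstFit.

(** * Lower bounds on the optimum *)

Section Optimum.
Context {R : realFieldType} (D : seq R) (S : R) (k : nat).
Hypotheses (S_gt0 : 0 < S)
  (D_le : forall j, (j < size D)%N -> 0 < D`_j /\ D`_j <= S).

(** Double counting: each item lies in exactly [k] bins of a packing, and each bin weighs at most
    [c]. *)
Lemma OPT_weight_ge (f : R -> R) (c : R) :
  (forall s : seq R, {in s, forall x, 0 <= x} -> \sum_(x <- s) x <= 1 ->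
    \sum_(x <- s) f x <= c) ->
  k%:R * \sum_(j <- iota 0 (size D)) f (D`_j / S) <= c * (OPT D S k)%:R.
Proof.
move=> f_le; pose g j := f (D`_j / S).
have bin_le (B : {set 'I_(size D)}) : \sum_(j in B) D`_j <= S ->
    \sum_(j in B) g j <= c.
  move=> BS; have := f_le [seq D`_(val j) / S | j <- enum B].
  rewrite !big_map !big_enum /=; apply.
    move=> x /mapP[j _ ->]; have [/ltW ? _] := D_le _ (ltn_ord j).
    by rewrite divr_ge0 // ltW.
  by rewrite -mulr_suml ler_pdivrMr // mul1r.
have -> : \sum_(j <- iota 0 (size D)) f (D`_j / S) = \sum_(j < size D) g j.
  by rewrite -(subn0 (size D)) -/(index_iota _ _) big_mkord subn0.
rewrite /OPT; apply: (big_ind (fun m => k%:R * \sum_(j < size D) g j <= c * m%:R)).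
(* The default value of the minimum must obey the bound too: each item fits alone in a bin, so it
   weighs at most [c]. *)
- have : \sum_(j < size D) g j <= \sum_(j < size D) c.
    apply: ler_sum => j _; have := bin_le [set j]; rewrite !big_set1; apply.
    by have [] := D_le _ (ltn_ord j).
  rewrite sumr_const card_ord natrM => le_c.
  by rewrite (mulrC (size D)%:R) mulrCA ler_wpM2l // mulr_natr.
- by move=> m n ? ?; rewrite /minn; case: ifP.
move=> m /existsP[P /andP[/forallP cap /forallP cnt]].
have -> : k%:R * \sum_(j < size D) g j = \sum_(b < m) \sum_(j in tnth P b) g j.
  rewrite mulr_sumr (exchange_big_dep xpredT) //=; apply: eq_bigr => j _.
  rewrite sumr_const -[RHS]mulr_natl; congr (_%:R * _).
  apply: etrans (esym (eqP (cnt j))) _.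
  by rewrite -sum1_count big_tuple sum1_card.
have : \sum_(b < m) \sum_(j in tnth P b) g j <= \sum_(b < m) c.
  by apply: ler_sum => b _; apply: bin_le; apply: cap.
by rewrite sumr_const card_ord mulr_natr.
Qed.

End Optimum.

Theorem theorem2 (R : realFieldType) (D : seq R) (S : R) (k : nat) :
  0 < S ->
  (forall j : nat, (j < size D)%N -> 0 < D`_j /\ D`_j <= S) ->
  (1 <= k)%N ->
  ((FFk D S k)%:R : R) <= (3%:R / 2%:R + 1 / (5 * k)%N%:R) * (OPT D S k)%:R + 3 * k%:R.
Proof.
move=> S_gt0 D_le k_gt0.
have D_ge0 j : 0 <= D`_j.
  have [/D_le[/ltW //]|size_le] := ltnP j (size D).
  by rewrite nth_default.
have k_pos : 0 < k%:R :> R by rewrite ltr0n.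
have opt_weight := OPT_weight_ge D S k S_gt0 D_le.
set o : R := (OPT D S k)%:R in opt_weight *.
(* One copy of every item carries a [k]-th of the total weight, so [beta] is 3/2 OPT / k. *)
have le_beta (f : R -> R) c : (forall s : seq R, {in s, forall x, 0 <= x} ->
    \sum_(x <- s) x <= 1 -> \sum_(x <- s) f x <= c) ->
    \sum_(j <- iota 0 (size D)) f (D`_j / S) <= c * o / k%:R.
  by move=> /opt_weight; rewrite ler_pdivlMr // mulrC.
have := rounds_le D S S_gt0 D_ge0 _ k (le_beta _ _ sum_weight_bin)
          (le_beta _ _ sum_count_weight_bin).
have := le_beta _ _ sum_deficit_bin.
rewrite -/(FFk_bins D S k) -/(FFk D S k) => le_def /le_trans; apply.
rewrite lerD2r natrM.
apply: le_trans (lerD (lexx _) le_def) _.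
rewrite le_eqVlt; apply/orP; left; apply/eqP; field.
by rewrite gt_eqF.
Qed.
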